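(* There are a Martin-Löf random bit sequence $X\in\{0,1\}^{\mathbb N}$ and a bit sequence $Y\in\{0,1\}^{\mathbb N}$ that is not Martin-Löf random such that there is a constant $c$ with $K(X\upharpoonright n)+K(Y\upharpoonright n)\geq 2n-c$ for all $n$.
   Context: $K(x)$ denotes prefix-free Kolmogorov complexity of a binary string $x$; $Z\upharpoonright n$ is the string of the first $n$ bits of $Z$. Martin-Löf randomness is with respect to the uniform measure $\lambda$ on $\{0,1\}^{\mathbb N}$: $Z$ is Martin-Löf random if $Z\notin\bigcap_m G_m$ for every sequence $(G_m)$ of uniformly effectively open sets with $\lambda(G_m)\le 2^{-m}$. *)

(* Defs.v *)
From HB Require Import structures.
From mathcomp Require Import all_boot all_order all_algebra.
From mathcomp Require Import all_classical all_reals all_analysis.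
From mathcomp Require Import zify lra.
From Stdlib Require Cantor.

Set Implicit Arguments.
Unset Strict Implicit.
Unset Printing Implicit Defensive.

Import Order.TTheory GRing.Theory Num.Theory.
Import numFieldNormedType.Exports.

Local Open Scope classical_set_scope.
Local Open Scope nat_scope.

(* Multi-argument functions are handled through the Cantor pairing.
   The identity is [Pair Left Right]. *)
Inductive code : Type :=
| Zero | Succ | Left | Right
| Pair of code & code
| Comp of code & code
| Prec of code & code
| Mu of code.

Definition npair (x y : nat) : nat := Cantor.to_nat (x, y).

(* Unbounded search: the least [n] such that [f <a, n> = 0], provided that
   [f <a, k>] is defined for all [k < n]; undefined if there is none. *)
Definition mu_stop (f : nat -> option nat) (a : nat) : pred nat :=
  fun n => (f (npair a n) == Some 0) &&
           all (fun k => f (npair a k) != None) (iota 0 n).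

Definition mu_rec (f : nat -> option nat) (a : nat) : option nat :=
  if pselect (exists n, mu_stop f a n) is left ex then Some (ex_minn ex)
  else None.

(* [None] means that the computation diverges. *)
Fixpoint eval (c : code) : nat -> option nat :=
  match c with
  | Zero => fun=> Some 0
  | Succ => fun n => Some n.+1
  | Left => fun n => Some (Cantor.of_nat n).1
  | Right => fun n => Some (Cantor.of_nat n).2
  | Pair f g => fun n =>
      obind (fun x => omap (npair x) (eval g n)) (eval f n)
  | Comp f g => fun n => obind (eval f) (eval g n)
  | Prec f g => fun n =>
      let: (a, k) := Cantor.of_nat n in
      nat_rect (fun=> option nat) (eval f a)
        (fun i => obind (fun r => eval g (npair a (npair i r)))) k
  | Mu f => mu_rec (eval f)
  end.

(* The bijection between binary strings and natural numbers given by
   bijective base 2 (digits 1 and 2, least significant digit first). *)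
Fixpoint string_code (s : seq bool) : nat :=
  if s is b :: s' then (b + (string_code s').*2).+1 else 0.

Definition computable_string_fun (M : seq bool -> option (seq bool)) : Prop :=
  exists c : code, forall p, eval c (string_code p) = omap string_code (M p).

Definition prefix_free_machine (M : seq bool -> option (seq bool)) : Prop :=
  computable_string_fun M /\
  forall p q, M p != None -> M q != None -> prefix p q -> p = q.

Definition optimal_prefix_free_machine (U : seq bool -> option (seq bool)) :
    Prop :=
  prefix_free_machine U /\
  forall M, prefix_free_machine M -> exists d : nat,
    forall p x, M p = Some x ->
      exists2 q, U q = Some x & size q <= size p + d.

Definition has_program (M : seq bool -> option (seq bool)) (x : seq bool) :
    pred nat :=
  fun n => `[< exists2 p, M p = Some x & size p = n >].

(* The default value 0 is never used when [U] is optimal. *)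
Definition prefix_complexity (U : seq bool -> option (seq bool))
    (x : seq bool) : nat :=
  if pselect (exists n, has_program U x n) is left ex then ex_minn ex else 0.

Definition bitseq_restr (Z : nat -> bool) (n : nat) : seq bool := mkseq Z n.

Definition cylinder (s : seq bool) : set (nat -> bool) :=
  [set Z | bitseq_restr Z (size s) = s].

Definition cantor_measurableType := g_sigma_algebraType (range cylinder).

Section uniform_measure.
Variable R : realType.
Local Open Scope ring_scope.

Definition binary_expansion (x : R) : cantor_measurableType :=
  fun n => odd (Num.truncn (2 ^+ n.+1 * x)).

Lemma truncn_set (k m : nat) : (0 < m)%N ->
  [set x : R | Num.truncn (2 ^+ k * x) = m] =
  `[m%:R / 2 ^+ k, m.+1%:R / 2 ^+ k[%classic.
Proof.
move=> m0; apply/seteqP; split=> x /=; rewrite in_itv/=.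
  move=> xm; have := truncn_gt0 (2 ^+ k * x); rewrite xm m0 => /esym y1.
  have /truncn_itv : 0 <= 2 ^+ k * x by rewrite (le_trans _ y1).
  by rewrite xm ler_pdivrMr ?exprn_gt0// ltr_pdivlMr ?exprn_gt0// mulrC.
rewrite ler_pdivrMr ?exprn_gt0// ltr_pdivlMr ?exprn_gt0// mulrC => xm.
exact/truncn_def.
Qed.

Lemma measurable_binary_digit (n : nat) :
  measurable [set x : R | binary_expansion x n].
Proof.
rewrite (_ : [set _ | _] = \bigcup_(m in [set m | odd m])
    [set x : R | Num.truncn (2 ^+ n.+1 * x) = m]).
  apply: bigcup_measurable => m /= om.
  by rewrite truncn_set//; case: m om.
apply/seteqP; split=> x /=.
  by move=> ox; exists (Num.truncn (2 ^+ n.+1 * x)).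
by case=> m /= om xm; rewrite /binary_expansion xm.
Qed.

Lemma cylinderE (s : seq bool) :
  cylinder s = [set Z | forall i : nat, (i < size s)%N -> Z i = nth false s i].
Proof.
apply/seteqP; split=> Z /=; rewrite /cylinder /bitseq_restr /=.
  by move=> <- i; rewrite size_mkseq => im; rewrite nth_mkseq.
move=> h; apply: (@eq_from_nth _ false); rewrite size_mkseq// => i im.
by rewrite nth_mkseq// h.
Qed.

Lemma measurable_binary_expansion : measurable_fun setT binary_expansion.
Proof.
apply: measurability => //.
move=> _ [_ [s _ <-] <-]; rewrite setTI cylinderE.
rewrite (_ : _ @^-1` _ = \bigcap_(i in `I_(size s))
    [set x : R | binary_expansion x i = nth false s i]).
  apply: bigcap_measurableType => i _.
  have mb := measurable_binary_digit i.
  case: (nth false s i) => //.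
  rewrite (_ : [set _ | _] = ~` [set x : R | binary_expansion x i]).
    exact: measurableC.
  by apply/seteqP; split=> x /=; [move=> ->|move/negP/negbTE].
by apply/seteqP; split.
Qed.

Definition binary_expansion_mfun :
    {mfun measurableTypeR R >-> cantor_measurableType} :=
  HB.pack binary_expansion
    (@isMeasurableFun.Build _ _ (measurableTypeR R) cantor_measurableType
       binary_expansion measurable_binary_expansion).

(* [cantor_measure_cylinder] below characterizes this measure: the cylinders
   generate the sigma-algebra and, with the empty set, are closed under
   intersection. *)
Definition cantor_measure : probability cantor_measurableType R :=
  distribution (uniform_prob (@ltr01 R)) binary_expansion_mfun.

Definition string_value : seq bool -> nat :=
  foldl (fun v (b : bool) => v.*2 + b)%N 0%N.

Lemma truncn_half (y : R) : 0 <= y -> (Num.truncn (2 * y))./2 = Num.truncn y.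
Proof.
move=> y0; apply/esym/truncn_def.
have /truncn_itv : 0 <= 2 * y by rewrite mulr_ge0.
set m := Num.truncn _ => /andP[my ym].
have e : (m%:R : R) = (odd m)%:R + 2 * (m./2)%:R.
  by rewrite -natrM -natrD mul2n odd_double_half.
rewrite -(natr1 m) in ym; rewrite e in my ym; rewrite -natr1.
by case: (odd m) my ym => /= my ym; apply/andP; split; lra.
Qed.

Lemma mem_cylinder_binary_expansion (s : seq bool) (x : R) : 0 <= x < 1 ->
  cylinder s (binary_expansion x) <->
  Num.truncn (2 ^+ size s * x) = string_value s.
Proof.
move=> /andP[x0 x1]; elim/last_ind: s => [|s b IH].
  rewrite /= expr0 mul1r /string_value /=; split=> // _.
  by apply: truncn_def; rewrite x0.
rewrite /string_value foldl_rcons -/string_value size_rcons.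
have -> : cylinder (rcons s b) (binary_expansion x) <->
    cylinder s (binary_expansion x) /\ binary_expansion x (size s) = b.
  rewrite /cylinder /bitseq_restr/= size_rcons mkseqS; split.
    by move=> /rcons_inj[].
  by case=> -> ->.
rewrite IH /binary_expansion.
have y0 : 0 <= 2 ^+ size s * x by rewrite mulr_ge0// exprn_ge0.
have := truncn_half y0; rewrite mulrA -exprS => <-.
move: (Num.truncn _) (string_value s) => m v.
have mE := odd_double_half m.
split=> [[<- <-]|e]; first by rewrite addnC.
have om : odd m = b by rewrite e oddD odd_double; case: (b).
split=> //; apply: double_inj; apply/eqP.
by rewrite -(eqn_add2l (odd m)) mE om addnC -e.
Qed.

Lemma string_value_lt (s : seq bool) : (string_value s < 2 ^ size s)%N.
Proof.
elim/last_ind: s => // s b; rewrite /string_value foldl_rcons size_rcons expnS.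
by case: b; lia.
Qed.

Lemma cantor_measure_cylinder (s : seq bool) :
  cantor_measure (cylinder s) = ((2 ^- size s)%:E)%E.
Proof.
rewrite /cantor_measure /distribution /pushforward/=.
set A := binary_expansion @^-1` cylinder s.
set v := string_value s.
pose I : set R := `[v%:R / 2 ^+ size s, v.+1%:R / 2 ^+ size s[%classic.
have p0 : 0 < (2 : R) ^+ size s by rewrite exprn_gt0.
have mA : measurable A.
  rewrite -[A]setTI; apply: measurable_binary_expansion => //.
  by apply: sub_sigma_algebra; exists s.
have mI : measurable I by exact: measurable_itv.
have v1 : v.+1%:R / 2 ^+ size s <= 1 :> R.
  by rewrite ler_pdivrMr// mul1r -natrX ler_nat string_value_lt.
have AI (x : R) : 0 <= x < 1 -> A x <-> I x.
  move=> x01; rewrite /A /= mem_cylinder_binary_expansion// /I/= in_itv/=.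
  rewrite ler_pdivrMr// ltr_pdivlMr// ![x * _]mulrC -truncn_eq; last first.
    by case/andP: x01 => x0 _; rewrite mulr_ge0// ltW.
  by split=> [->//|/eqP].
have I01 x : I x -> 0 <= x < 1.
  rewrite /I/= in_itv/= => /andP[a b]; rewrite (lt_le_trans b v1) andbT.
  by rewrite (le_trans _ a)// divr_ge0// ltW.
have muI : lebesgue_measure I = (2 ^- size s)%:E :> \bar R.
  rewrite lebesgue_measure_itv/= lte_fin ltr_pM2r ?invr_gt0// ltr_nat ltnSn.
  by rewrite -EFinD -mulrBl -natrB// subSnn mul1r.
rewrite /uniform_prob integral_uniform_pdf.
rewrite (eq_integral (fun=> 1%:E)); last first.
  move=> x; rewrite inE => -[_]/=; rewrite in_itv/= /uniform_pdf => ->.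
  by rewrite subr0 invr1.
rewrite integral_cst//=; last by exact: measurableI.
rewrite mul1e -muI; apply/eqP; rewrite eq_le; apply/andP; split.
  have -> : lebesgue_measure I =
      lebesgue_measure (I `|` [set (1 : R)])%classic :> \bar R.
    rewrite measureU//= ?lebesgue_measure_set1 ?adde0//.
    apply/seteqP; split=> x//= [Ix x1]; have := I01 _ Ix.
    by rewrite x1 ltxx andbF.
  apply: le_measure; rewrite ?inE//; [exact: measurableI|exact: measurableU|].
  move=> x [Ax]/=; rewrite in_itv/= => /andP[x0].
  rewrite le_eqVlt => /orP[/eqP ->|x1]; first by right.
  by left; apply/AI; rewrite ?x0.
apply: le_measure; rewrite ?inE//; first exact: measurableI.
move=> x Ix; have x01 := I01 _ Ix; split; first exact/AI.
by rewrite /= in_itv/=; case/andP: x01 => -> /ltW ->.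
Qed.

End uniform_measure.

(* The computably enumerable sets of strings are the domains of the partial
   recursive functions. *)
Definition uniformly_effectively_open (G : nat -> set (nat -> bool)) : Prop :=
  exists c : code, forall m,
    G m = \bigcup_(s in [set s | eval c (npair m (string_code s)) != None])
            cylinder s.

Definition martin_lof_random (R : realType) (Z : nat -> bool) : Prop :=
  forall G : nat -> set (nat -> bool),
    uniformly_effectively_open G ->
    (forall m, (cantor_measure R (G m) <= ((2 ^- m)%R%:E))%E) ->
    ~ (\bigcap_m G m) Z.

(* Main.v *)
Require Import Defs.
From mathcomp Require Import all_boot all_order all_algebra.
From mathcomp Require Import all_classical all_reals all_analysis.
From mathcomp Require Import zify ring lra.

(* Spread the programs of [U] over the measure
     mu A = \sum_(p in dom U) 2 ^ (|U p| - |p|) * lambda (A `&` [U p]),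
   of total mass at most 1 by Kraft's inequality. The martingale
   M s = 2 ^ |s| * mu [s] satisfies M s >= 2 ^ (|s| - K s), and by Ville's
   inequality the sets {Z | M is larger than 2 ^ d on some prefix of Z} form a
   Martin-Loef test, so that M is bounded along every random sequence.

   Let X be random. Since \sum_(j < n) 2 ^ (j - K (X|j)) <= M (X|n) is bounded,
   g n = 2 ^ (K (X|n) - n) tends to infinity. It is thus enough to find Y along
   which M is unbounded (so that Y is not random) but at most max 1 (g n), for
   then n - K (Y|n) is at most max 0 (K (X|n) - n), where K (X|n) - n is
   bounded below. Such a Y is obtained by alternating long phases in which M
   does not increase, until g is large enough, with runs of zeros, along which
   M is unbounded but at most doubles at each step. *)

Set Implicit Arguments.
Unset Strict Implicit.
Unset Printing Implicit Defensive.

Import Order.TTheory GRing.Theory Num.Theory.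
Import numFieldNormedType.Exports.
Import Defs.

(** * Closure properties of the partial computable functions *)

Definition computable_partial (f : nat -> option nat) : Prop :=
  exists c, eval c =1 f.

Definition computable (f : nat -> nat) : Prop :=
  computable_partial (fun n => Some (f n)).

Notation lft n := (Cantor.of_nat n).1.
Notation rgt n := (Cantor.of_nat n).2.

Section computability.
Local Open Scope nat_scope.

Lemma npairK x y : Cantor.of_nat (npair x y) = (x, y).
Proof. exact: Cantor.cancel_of_to. Qed.

Lemma npair_lft_rgt n : npair (lft n) (rgt n) = n.
Proof. by rewrite /npair -surjective_pairing Cantor.cancel_to_of. Qed.

Lemma computable_partial_ext f g :
  f =1 g -> computable_partial f -> computable_partial g.
Proof. by move=> fg [c cf]; exists c => n; rewrite cf fg. Qed.

Lemma computable_ext f g : f =1 g -> computable f -> computable g.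
Proof. by move=> fg; apply: computable_partial_ext => n; rewrite fg. Qed.

Lemma computable_partial_comp f g : computable_partial f -> computable g ->
  computable_partial (fun n => f (g n)).
Proof. by move=> [c cf] [d dg]; exists (Comp c d) => n /=; rewrite dg /= cf. Qed.

Lemma computable_comp f g :
  computable f -> computable g -> computable (fun n => f (g n)).
Proof. exact: computable_partial_comp. Qed.

Lemma computable_lft : computable (fun n => lft n).
Proof. by exists Left. Qed.

Lemma computable_rgt : computable (fun n => rgt n).
Proof. by exists Right. Qed.

Lemma computable_pair f g :
  computable f -> computable g -> computable (fun n => npair (f n) (g n)).
Proof.
by move=> [c cf] [d dg]; exists (Pair c d) => n /=; rewrite dg /= cf.
Qed.

Lemma computable_id : computable id.
Proof.
by apply: computable_ext (computable_pair computable_lft computable_rgt) => n;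
  rewrite npair_lft_rgt.
Qed.

Lemma computable_succ f : computable f -> computable (fun n => (f n).+1).
Proof. by move=> cf; apply: computable_comp cf; exists Succ. Qed.

Lemma computable_cst m : computable (fun=> m).
Proof. by elim: m => [|m IH]; [exists Zero | exact: computable_succ]. Qed.

Lemma computable2 (h : nat -> nat -> nat) f g :
  computable (fun e => h (lft e) (rgt e)) -> computable f -> computable g ->
  computable (fun n => h (f n) (g n)).
Proof.
move=> ch cf cg.
by apply: computable_ext (computable_comp ch (computable_pair cf cg)) => n;
  rewrite npairK.
Qed.

Lemma computable_partial_bind (f : nat -> nat -> option nat) g :
  computable_partial (fun e => f (lft e) (rgt e)) -> computable_partial g ->
  computable_partial (fun n => obind (f n) (g n)).
Proof.
move=> [c cf] [d dg]; have [i di] := computable_id.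
exists (Comp c (Pair i d)) => n /=.
by rewrite di /= dg; case: (g n) => //= m; rewrite cf npairK.
Qed.

Lemma computable_partial_rec f (g : nat -> nat -> nat -> option nat) k :
  computable f -> computable k ->
  computable_partial (fun e => g (lft e) (lft (rgt e)) (rgt (rgt e))) ->
  computable_partial (fun n => nat_rect (fun=> option nat) (Some (f n))
    (fun i => obind (g n i)) (k n)).
Proof.
move=> [c cf] [d dk] [e eg]; have [i di] := computable_id.
exists (Comp (Prec c e) (Pair i d)) => n /=.
rewrite di /= dk /= npairK; elim: (k n) => [|m IH] /=; first exact: cf.
by rewrite IH; case: (nat_rect _ _ _ _) => //= r; rewrite eg !npairK.
Qed.

Lemma computable_rec f (g : nat -> nat -> nat -> nat) k :
  computable f -> computable k ->
  computable (fun e => g (lft e) (lft (rgt e)) (rgt (rgt e))) ->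
  computable (fun n => nat_rect (fun=> nat) (f n) (g n) (k n)).
Proof.
move=> cf ck cg; apply: computable_partial_ext
  (@computable_partial_rec f (fun n i r => Some (g n i r)) k cf ck cg) => n.
by elim: (k n) => [|m IH] /=; rewrite ?IH.
Qed.

(** The search runs over a function that ignores the search variable and is 0 exactly when [b]
    holds: it stops at once or never. This turns a decidable condition into a domain. *)
Lemma computable_partial_guard (b : pred nat) :
  computable (fun n => b n : nat) ->
  computable_partial (fun n => if b n then Some 0 else None).
Proof.
move=> cb; have [c cE] : computable (fun e => if b (lft e) then 0 else 1).
  apply: (@computable_ext (fun e => nat_rect (fun=> nat) 1 (fun _ _ => 0)
    (b (lft e)))) => [n|]; first by case: (b _).
  apply: (@computable_rec (fun=> 1) (fun _ _ _ => 0)).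
  - exact: computable_cst.
  - exact: (computable_comp cb computable_lft).
  - exact: computable_cst.
exists (Mu c) => n /=; rewrite /mu_rec; case: pselect => [ex|nex].
  case: ex_minnP => m /andP[+ _]; rewrite cE npairK /=.
  case bn: (b n) => //= _ /(_ 0); rewrite /mu_stop cE npairK /= bn /= leqn0.
  by move=> /(_ isT)/eqP ->.
case: ifP => // bn; case: nex; exists 0.
by rewrite /mu_stop cE npairK /= bn.
Qed.

Lemma computable_add f g :
  computable f -> computable g -> computable (fun n => f n + g n).
Proof.
apply: computable2.
apply: (@computable_ext (fun e => nat_rect (fun=> nat) (lft e)
  (fun _ => S) (rgt e))) => [n|].
  by elim: (rgt n) => [|m IH] /=; rewrite ?addn0// IH addnS.
apply: computable_rec; [exact: computable_lft|exact: computable_rgt|].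
apply: computable_succ; apply: (computable_comp computable_rgt computable_rgt).
Qed.

Lemma computable_mul f g :
  computable f -> computable g -> computable (fun n => f n * g n).
Proof.
apply: computable2.
apply: (@computable_ext (fun e => nat_rect (fun=> nat) 0
  (fun _ r => lft e + r) (rgt e))) => [n|].
  by elim: (rgt n) => [|m IH] /=; rewrite ?muln0// IH mulnS.
apply: computable_rec; [exact: computable_cst|exact: computable_rgt|].
apply: computable_add; first exact: (computable_comp computable_lft computable_lft).
exact: (computable_comp computable_rgt computable_rgt).
Qed.

Lemma computable_pred f : computable f -> computable (fun n => (f n).-1).
Proof.
move=> cf; apply: (computable_comp _ cf).
apply: (@computable_ext (fun e => nat_rect (fun=> nat) 0
  (fun i _ => i) e)) => [[]//|].
apply: computable_rec; [exact: computable_cst|exact: computable_id|].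
exact: (computable_comp computable_lft computable_rgt).
Qed.

Lemma computable_sub f g :
  computable f -> computable g -> computable (fun n => f n - g n).
Proof.
apply: computable2.
apply: (@computable_ext (fun e => nat_rect (fun=> nat) (lft e)
  (fun _ => predn) (rgt e))) => [n|].
  by elim: (rgt n) => [|m IH] /=; rewrite ?subn0// IH subnS.
apply: computable_rec; [exact: computable_lft|exact: computable_rgt|].
apply: computable_pred; exact: (computable_comp computable_rgt computable_rgt).
Qed.

Lemma computable_leq f g : computable f -> computable g ->
  computable (fun n => (f n <= g n) : nat).
Proof.
move=> cf cg; apply: (@computable_ext (fun n => 1 - (f n - g n))) => [n|].
  by rewrite /leq; case: (f n - g n).
by apply: computable_sub; [exact: computable_cst|exact: computable_sub].
Qed.

Lemma computable_eq f g : computable f -> computable g ->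
  computable (fun n => (f n == g n) : nat).
Proof.
move=> cf cg; apply: (@computable_ext (fun n => (f n <= g n) * (g n <= f n))).
  by move=> n; rewrite mulnb eqn_leq.
by apply: computable_mul; apply: computable_leq.
Qed.

Lemma computable_pow2 f : computable f -> computable (fun n => 2 ^ f n).
Proof.
move=> cf; apply: (computable_comp _ cf).
apply: (@computable_ext (fun e => nat_rect (fun=> nat) 1
  (fun _ r => r + r) e)) => [n|].
  by elim: n => //= m ->; rewrite expnS mul2n addnn.
apply: computable_rec; [exact: computable_cst|exact: computable_id|].
by apply: computable_add; apply: (computable_comp computable_rgt computable_rgt).
Qed.

Lemma computable_odd f : computable f -> computable (fun n => odd (f n) : nat).
Proof.
move=> cf; apply: (@computable_comp (fun n => odd n : nat) f _ cf).
apply: (@computable_ext (fun e => nat_rect (fun=> nat) 0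
  (fun _ r => 1 - r) e)) => [n|].
  by elim: n => //= m ->; case: (odd m).
apply: computable_rec; [exact: computable_cst|exact: computable_id|].
apply: computable_sub; first exact: computable_cst.
exact: (computable_comp computable_rgt computable_rgt).
Qed.

Lemma computable_half f : computable f -> computable (fun n => (f n)./2).
Proof.
move=> cf; apply: (@computable_comp half f _ cf).
(* The recursion is floor((i + 1) / 2) = i - floor(i / 2). *)
apply: (@computable_ext (fun e => nat_rect (fun=> nat) 0
  (fun i r => i - r) e)) => [n|].
  by elim: n => //= m ->; rewrite uphalfE; lia.
apply: computable_rec; [exact: computable_cst|exact: computable_id|].
apply: computable_sub; first exact: (computable_comp computable_lft computable_rgt).
exact: (computable_comp computable_rgt computable_rgt).
Qed.

Lemma computable_div_pow2 f g : computable f -> computable g ->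
  computable (fun n => f n %/ 2 ^ g n).
Proof.
apply: (@computable2 (fun x y => x %/ 2 ^ y)).
apply: (@computable_ext (fun e => nat_rect (fun=> nat) (lft e)
  (fun _ => half) (rgt e))) => [n|].
  elim: (rgt n) => [|m IH] /=; first by rewrite divn1.
  by rewrite IH expnSr divnMA divn2.
apply: computable_rec; [exact: computable_lft|exact: computable_rgt|].
apply: computable_half; exact: (computable_comp computable_rgt computable_rgt).
Qed.

Lemma computable_mod_pow2 f g : computable f -> computable g ->
  computable (fun n => f n %% 2 ^ g n).
Proof.
move=> cf cg.
apply: (@computable_ext (fun n => f n - f n %/ 2 ^ g n * 2 ^ g n)) => [n|].
  by rewrite {1}(divn_eq (f n) (2 ^ g n)) addKn.
apply: computable_sub => //; apply: computable_mul.
  exact: computable_div_pow2.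
exact: computable_pow2.
Qed.

(** The strings of length [l] have the codes from 2^l - 1 to 2^(l+1) - 2, so the length can be read
    off the code. *)
Definition decoded_size (n : nat) : nat := trunc_log 2 n.+1.

Lemma computable_decoded_size f :
  computable f -> computable (fun n => decoded_size (f n)).
Proof.
move=> cf; apply: (@computable_comp decoded_size f _ cf).
apply: (@computable_ext (fun e => nat_rect (fun=> nat) 0
  (fun i r => r + (2 ^ r.+1 <= i.+2)) e)) => [n|].
  elim: n => [|m IH] /=; first by rewrite /decoded_size trunc_log1.
  rewrite IH /decoded_size; set l := trunc_log 2 m.+1.
  have /andP[l1 l2] := @trunc_log_bounds 2 m.+1 isT isT; rewrite -/l in l1 l2.
  apply/esym/trunc_log_eq => //; move: l1 l2; rewrite !expnS.
  have := expn_gt0 2 l.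
  by case: (leqP (2 * 2 ^ l) m.+2) => /=; rewrite ?addn0 ?addn1 ?expnS; lia.
have cr := computable_comp computable_rgt computable_rgt.
apply: computable_rec; [exact: computable_cst|exact: computable_id|].
apply: computable_add => //; apply: computable_leq.
  by apply: computable_pow2; apply: computable_succ.
do 2!apply: computable_succ.
exact: (computable_comp computable_lft computable_rgt).
Qed.

(** * Arithmetic of string codes *)

Lemma string_code_cat s t :
  string_code (s ++ t) = string_code s + 2 ^ size s * string_code t.
Proof.
by elim: s => [|b s IH] /=; rewrite ?mul1n// IH expnS -!muln2; ring.
Qed.

Lemma string_code_bounds s :
  2 ^ size s <= (string_code s).+1 < 2 ^ (size s).+1.
Proof.
by elim: s => // b s; rewrite /= !expnS; case: b => /=; lia.
Qed.

Lemma decoded_size_string_code s : decoded_size (string_code s) = size s.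
Proof. exact/trunc_log_eq/string_code_bounds. Qed.

Lemma string_code_inj : injective string_code.
Proof.
elim=> [|b s IH] [|b' s'] //= [] e.
have bb : b = b' by move: e; case: (b); case: (b'); lia.
by rewrite bb (IH s')//; move: e; rewrite bb; lia.
Qed.

Lemma string_code_surj n : exists s, string_code s = n.
Proof.
elim/ltn_ind: n => -[|n] IH; first by exists [::].
have [|s sE] := IH n./2; first by lia.
by exists (odd n :: s) => /=; rewrite sE odd_double_half.
Qed.

(** The code plus one is 2^|s| plus the number whose binary digits are the bits of [s], lowest
    first; reduction modulo 2^j keeps the first [j] bits. Comparing prefixes thus becomes arithmetic
    on codes. *)
Lemma string_code_mod j (s : seq bool) : j <= size s ->
  (string_code s).+1 %% 2 ^ j = (string_code (take j s)).+1 - 2 ^ j.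
Proof.
move=> js; rewrite -{1}(cat_take_drop j s) string_code_cat.
have := string_code_bounds (take j s); rewrite size_takel// expnS => b.
rewrite -addSn addnC mulnC modnMDl -{1}(@subnK (2 ^ j) (string_code _).+1); last by lia.
by rewrite modnDr modn_small//; lia.
Qed.

Lemma take_eq_string_code j (s t : seq bool) : j <= size s -> j <= size t ->
  (take j s == take j t) =
  ((string_code s).+1 %% 2 ^ j == (string_code t).+1 %% 2 ^ j).
Proof.
move=> js jt; rewrite !string_code_mod//; apply/eqP/eqP => [->//|e].
apply: string_code_inj.
have := string_code_bounds (take j s); have := string_code_bounds (take j t).
by rewrite !size_takel// !expnS; lia.
Qed.

(** A finite set of programs is coded by the binary digits of one number; this serves as advice in
    the test. *)
Lemma exists_bits (b : pred nat) k :
  exists m, forall i, i < k -> odd (m %/ 2 ^ i) = b i.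
Proof.
elim: k b => [|k IH] b; first by exists 0.
have [m mE] := IH (fun i => b i.+1); exists (b 0 + m.*2) => -[_|i ik].
  by rewrite divn1 oddD odd_double; case: (b 0).
by rewrite expnS divnMA divn2 half_bit_double mE.
Qed.

End computability.

(** * Cylinders and Ville's inequality *)

Section strings_as_numbers.
Local Open Scope nat_scope.

(** This inverse of [string_code] lets families of strings be indexed by numbers, as the series
    below require. *)
Definition string_decode n : seq bool := sval (cid (string_code_surj n)).

Lemma string_decodeK : cancel string_decode string_code.
Proof. by move=> n; exact: svalP (cid (string_code_surj n)). Qed.

Lemma string_codeK : cancel string_code string_decode.
Proof. by move=> s; apply: string_code_inj; rewrite string_decodeK. Qed.

Lemma size_string_decode n : size (string_decode n) = decoded_size n.
Proof. by rewrite -{2}(string_decodeK n) decoded_size_string_code. Qed.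

Lemma take_bitseq_restr (Z : nat -> bool) m n :
  m <= n -> take m (bitseq_restr Z n) = bitseq_restr Z m.
Proof.
move=> mn.
by rewrite /bitseq_restr /mkseq -map_take take_iota (minn_idPl mn).
Qed.

Lemma size_bitseq_restr Z n : size (bitseq_restr Z n) = n.
Proof. exact: size_mkseq. Qed.

Lemma mem_cylinder_restr Z n : cylinder (bitseq_restr Z n) Z.
Proof. by rewrite /cylinder /= size_bitseq_restr. Qed.

Lemma cylinder_prefix s t Z :
  cylinder s Z -> cylinder t Z -> size s <= size t -> prefix s t.
Proof.
rewrite /cylinder /= => sE tE st.
by rewrite -sE -tE prefixE size_bitseq_restr take_bitseq_restr ?tE// sE.
Qed.

Lemma sub_cylinder s t : prefix s t -> (cylinder t `<=` cylinder s)%classic.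
Proof.
move=> /[dup] /size_prefix st; rewrite prefixE => /eqP sE Z; rewrite /cylinder /=.
by move=> tE; rewrite -[in RHS]sE -tE take_bitseq_restr.
Qed.

End strings_as_numbers.

Section cantor_space.
Variable R : realType.
Local Open Scope classical_set_scope.
Local Open Scope ring_scope.
Local Notation lam := (cantor_measure R).

Lemma measurable_cylinder s : measurable (cylinder s : set cantor_measurableType).
Proof. by apply: sub_sigma_algebra; exists s. Qed.

Lemma cylinder_nil : cylinder [::] = setT.
Proof. by apply/seteqP; split. Qed.

Lemma cylinder_rcons s :
  cylinder s = cylinder (rcons s false) `|` cylinder (rcons s true).
Proof.
apply/seteqP; split => Z /=; rewrite /cylinder /= !size_rcons.
  by rewrite /bitseq_restr mkseqS => ->; case: (Z _); [right|left].
by rewrite /bitseq_restr !mkseqS => -[] /rcons_inj[].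
Qed.

Lemma cylinder_rcons_disjoint s :
  cylinder (rcons s false) `&` cylinder (rcons s true) = set0.
Proof.
apply/seteqP; split => Z //= -[]; rewrite /cylinder /= !size_rcons => ->.
by move/rcons_inj => [].
Qed.

Definition prefix_free (A : set (seq bool)) :=
  forall p q, A p -> A q -> prefix p q -> p = q.

Lemma trivIset_cylinder A : prefix_free A ->
  trivIset [set i | A (string_decode i)] (fun i => cylinder (string_decode i)).
Proof.
move=> pf i j /= Ai Aj [Z [iZ jZ]]; apply: (can_inj string_decodeK).
have /orP[ij|ji] := leq_total (size (string_decode i)) (size (string_decode j)).
  by apply: pf => //; exact: cylinder_prefix iZ jZ ij.
by apply/esym; apply: pf => //; exact: cylinder_prefix jZ iZ ji.
Qed.

Lemma measure_prefix_free (mu : {measure set cantor_measurableType -> \bar R}) A :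
  prefix_free A ->
  (mu (\bigcup_(s in A) cylinder s) =
   \sum_(i <oo | string_decode i \in A) mu (cylinder (string_decode i)))%E.
Proof.
move=> pf; rewrite (_ : \bigcup_(s in A) _ =
    \bigcup_(i in [set i | A (string_decode i)]) cylinder (string_decode i)).
  rewrite measure_bigcup//; last exact: trivIset_cylinder.
  by move=> i _; exact: measurable_cylinder.
apply/seteqP; split=> Z [s As sZ].
  by exists (string_code s); rewrite /= string_codeK.
by exists (string_decode s).
Qed.

Lemma measurable_bigcup_cylinder A :
  measurable (\bigcup_(s in A) cylinder s : set cantor_measurableType).
Proof.
rewrite (_ : \bigcup_(s in A) _ =
    \bigcup_(i in [set i | A (string_decode i)]) cylinder (string_decode i)).
  by apply: bigcup_measurable => i _; exact: measurable_cylinder.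
apply/seteqP; split=> Z [s As sZ].
  by exists (string_code s); rewrite /= string_codeK.
by exists (string_decode s).
Qed.

(* The union is rewritten as the disjoint union over the minimal elements. *)
Lemma bigcup_cylinder_prefix_free (A : set (seq bool)) : exists2 B : set (seq bool),
  B `<=` A /\ prefix_free B &
  \bigcup_(s in A) cylinder s = \bigcup_(s in B) cylinder s.
Proof.
exists [set s | A s /\ forall t, A t -> prefix t s -> t = s].
  by split=> [s []//|s t [As _] [_ tm] st]; exact: tm.
apply/seteqP; split=> Z [s]; last by case=> As _ sZ; exists s.
move=> As sZ.
have [n nP nmin] : exists2 n, A (bitseq_restr Z n) &
    forall m, A (bitseq_restr Z m) -> (n <= m)%N.
  have ex : exists n, `[< A (bitseq_restr Z n) >].
    by exists (size s); apply/asboolP; rewrite sZ.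
  case: (ex_minnP ex) => n /asboolP An nmin; exists n => // m Am.
  by apply: nmin; apply/asboolP.
exists (bitseq_restr Z n); last exact: mem_cylinder_restr.
split=> // t At /[dup] /size_prefix; rewrite size_bitseq_restr => tn.
rewrite prefixE take_bitseq_restr// => /eqP tE; rewrite -tE in At *.
by congr bitseq_restr; apply/eqP; rewrite eqn_leq tn nmin.
Qed.

(* Ville's inequality for the martingale [mu (cylinder s) / lam (cylinder s)]. *)
Lemma measure_bigcup_cylinder_le
    (mu : {measure set cantor_measurableType -> \bar R}) d :
  (mu setT <= 1)%E ->
  (lam (\bigcup_(s in [set s | (2 ^+ d)%:E * lam (cylinder s) < mu (cylinder s)])
     cylinder s) <= (2 ^- d)%:E)%E.
Proof.
move=> mu1.
(* On a prefix-free subset the cylinders are disjoint, so the bounds lam [s] <= 2^-d * mu [s] add up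
   to at most 2^-d times the total mass. *)
have [B [BA pf] ->] := bigcup_cylinder_prefix_free
  [set s | ((2 ^+ d)%:E * lam (cylinder s) < mu (cylinder s))%E].
rewrite measure_prefix_free//.
have d0 : 0 < 2 ^- d :> R by rewrite invr_gt0 exprn_gt0.
apply: (@le_trans _ _ (\sum_(i <oo | string_decode i \in B)
    (2 ^- d)%:E * mu (cylinder (string_decode i)))%E).
  apply: lee_nneseries => // i; rewrite inE => /BA /ltW /=.
  by rewrite lee_pdivlMl ?exprn_gt0.
rewrite nneseriesZl// -measure_prefix_free// -[leRHS]mule1.
rewrite lee_pmul2l//; apply: le_trans mu1; apply: le_measure; rewrite ?inE//.
exact: measurable_bigcup_cylinder.
Qed.

End cantor_space.

(** * The martingale of the programs of a prefix-free machine *)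

Section program_martingale.
Variables (R : realType) (U : seq bool -> option (seq bool)).
Local Open Scope classical_set_scope.
Local Open Scope ring_scope.
Local Notation lam := (cantor_measure R).

Definition program_cylinder i : set cantor_measurableType :=
  oapp cylinder set0 (U (string_decode i)).

Lemma measurable_program_cylinder i : measurable (program_cylinder i).
Proof.
rewrite /program_cylinder; case: (U _) => [t|] /=; last exact: measurable0.
exact: measurable_cylinder.
Qed.

(** The output [t] has a cylinder of measure 2^-|t|, so with this weight a halting program [p]
    contributes the mass 2^-|p|. *)
Definition program_weight i : R :=
  if U (string_decode i) is Some t
  then 2 ^+ size t / 2 ^+ size (string_decode i) else 0.

Lemma program_weight_ge0 i : 0 <= program_weight i.
Proof.
by rewrite /program_weight; case: (U _) => // t; rewrite divr_ge0// exprn_ge0.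
Qed.

Definition program_measure : {measure set cantor_measurableType -> \bar R} :=
  mseries (fun i => mscale (NngNum (program_weight_ge0 i))
    (mrestr lam (measurable_program_cylinder i))) 0.

(* The contribution of the program [i] to
   [2 ^ size s * program_measure (cylinder s)]. *)
Definition program_gain (s : seq bool) (i : nat) : R :=
  if U (string_decode i) is Some t then
    let j := minn (size t) (size s) in
    if take j t == take j s then 2 ^+ j / 2 ^+ size (string_decode i) else 0
  else 0.

Lemma program_gain_ge0 s i : 0 <= program_gain s i.
Proof.
by rewrite /program_gain; case: (U _) => // t; case: ifP.
Qed.

Lemma program_measure_cylinder s :
  program_measure (cylinder s) =
  (\sum_(i <oo) (program_gain s i / 2 ^+ size s)%:E)%E.
Proof.
apply: eq_eseriesr => i _.
transitivity ((program_weight i)%:E * lam (cylinder s `&` program_cylinder i))%E.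
  by [].
rewrite /program_weight /program_gain /program_cylinder.
case: (U _) => [t|]; cbn [Option.apply]; last by rewrite mul0e mul0r.
set d := (X in X^-1); have d0 : d != 0 by rewrite expf_neq0.
have n0 m : 2 ^+ m != 0 :> R by rewrite expf_neq0.
(* Two cylinders are nested or disjoint; the shorter string decides which intersection remains. *)
have [st|ts] := leqP (size t) (size s).
- rewrite take_size; have [tE|tE] := eqVneq t (take (size t) s).
    rewrite setIidl; last by apply: sub_cylinder; rewrite prefixE -tE.
    by rewrite cantor_measure_cylinder -EFinM; congr EFin; field; rewrite d0 n0.
  rewrite (_ : _ `&` _ = set0) ?measure0 ?mule0 ?mul0r//.
  apply/seteqP; split=> Z //= -[sZ tZ].
  by move: (cylinder_prefix tZ sZ st) tE; rewrite prefixE eq_sym => ->.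
- rewrite take_size; have [tE|tE] := eqVneq (take (size s) t) s.
    rewrite setIidr; last by apply: sub_cylinder; rewrite prefixE tE.
    by rewrite cantor_measure_cylinder -EFinM; congr EFin; field; rewrite d0 !n0.
  rewrite (_ : _ `&` _ = set0) ?measure0 ?mule0 ?mul0r//.
  apply/seteqP; split=> Z //= -[sZ tZ].
  by move: (cylinder_prefix sZ tZ (ltnW ts)) tE; rewrite prefixE => ->.
Qed.

Hypothesis prefix_free_dom : prefix_free [set p | U p != None].

(** Kraft's inequality: the total mass is the measure of the union of the cylinders of the halting
    programs themselves, which are disjoint. *)
Lemma program_measure_le1 : (program_measure setT <= 1)%E.
Proof.
rewrite -cylinder_nil program_measure_cylinder.
have -> : (\sum_(i <oo) (program_gain [::] i / 2 ^+ size ([::] : seq bool))%:E =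
    \sum_(i <oo | string_decode i \in [set p | U p != None])
      lam (cylinder (string_decode i)))%E; last first.
  rewrite -measure_prefix_free//; apply: probability_le1.
  exact: measurable_bigcup_cylinder.
rewrite [RHS]eseries_mkcond; apply: eq_eseriesr => i _.
rewrite cantor_measure_cylinder /program_gain; case: ifPn => [/set_mem|].
  rewrite /=; case: (U _) => // t _; rewrite minn0 !take0 eqxx.
  by rewrite expr0 divr1 mul1r.
by rewrite notin_setE /=; case: (U _) => [t []|_]; rewrite ?mul0r.
Qed.

Definition program_martingale (s : seq bool) : R :=
  2 ^+ size s * fine (program_measure (cylinder s)).

Lemma program_measure_fin s :
  program_measure (cylinder s) = (fine (program_measure (cylinder s)))%:E.
Proof.
rewrite fineK// ge0_fin_numE//; apply: le_lt_trans (ltry 1).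
apply: le_trans program_measure_le1; apply: le_measure; rewrite ?inE//.
exact: measurable_cylinder.
Qed.

Lemma program_martingaleE s :
  program_measure (cylinder s) = (program_martingale s / 2 ^+ size s)%:E.
Proof. by rewrite program_measure_fin /program_martingale mulrC mulKf// expf_neq0. Qed.

Lemma program_martingale_ge0 s : 0 <= program_martingale s.
Proof. by rewrite mulr_ge0// ?exprn_ge0// fine_ge0. Qed.

Lemma program_martingale_nil : program_martingale [::] <= 1.
Proof.
by have := program_measure_le1; rewrite -cylinder_nil program_martingaleE expr0 divr1.
Qed.

Lemma program_martingale_rcons s :
  program_martingale (rcons s false) + program_martingale (rcons s true) =
  2 * program_martingale s.
Proof.
have mc := measurable_cylinder.
have : program_measure (cylinder s) = (program_measure (cylinder (rcons s false)) +
    program_measure (cylinder (rcons s true)))%E.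
  rewrite [in LHS]cylinder_rcons measureU//.
  exact: cylinder_rcons_disjoint.
rewrite !program_martingaleE !size_rcons -EFinD => -[] e.
have n0 m : 2 ^+ m != 0 :> R by rewrite expf_neq0.
move/(congr1 ( *%R^~ (2 ^+ (size s).+1))) : e.
by rewrite mulrDl !mulfVK// exprS mulrCA mulfVK// mulrC => ->.
Qed.

Lemma program_martingale_partial s k :
  \sum_(i < k) program_gain s i <= program_martingale s.
Proof.
have s0 : 0 < 2 ^+ size s :> R by rewrite exprn_gt0.
rewrite -(@ler_pM2r _ (2 ^+ size s)^-1) ?invr_gt0// -lee_fin -program_martingaleE.
rewrite program_measure_cylinder mulr_suml -sumEFin -(big_mkord xpredT
  (fun i => (program_gain s i / 2 ^+ size s)%:E)).
by apply: nneseries_lim_ge => i _ _; rewrite lee_fin divr_ge0 ?program_gain_ge0// ltW.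
Qed.

(** The value is the limit of its partial sums, so a strict lower bound is already witnessed by
    finitely many programs. This makes large values of the martingale enumerable. *)
Lemma program_martingale_approx s B : B < program_martingale s ->
  exists k, B < \sum_(i < k) program_gain s i.
Proof.
have s0 : 0 < 2 ^+ size s :> R by rewrite exprn_gt0.
move=> BM; apply: contrapT => /forallNP nB; move: BM; apply/negP; rewrite -leNgt.
rewrite -(@ler_pM2r _ (2 ^+ size s)^-1) ?invr_gt0// -lee_fin -program_martingaleE.
rewrite program_measure_cylinder; apply: lime_le.
  apply: is_cvg_nneseries => i _ _.
  by rewrite lee_fin divr_ge0 ?program_gain_ge0// ltW.
apply: nearW => k; rewrite sumEFin lee_fin -mulr_suml ler_pM2r ?invr_gt0//.
by have /negP := nB k; rewrite -leNgt big_mkord.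
Qed.

End program_martingale.

(** * A path along which a martingale grows slowly *)

Section slow_path.
Variables (R : realType) (M : seq bool -> R) (g : nat -> R).
Local Open Scope ring_scope.

Hypothesis M_nil : M [::] <= 1.
Hypothesis M_ge0 : forall s, 0 <= M s.
Hypothesis M_rcons : forall s, M (rcons s false) + M (rcons s true) = 2 * M s.
Hypothesis M_zeros : forall s B, exists k, B < M (s ++ nseq k false).
Hypothesis g_unbounded : forall B, exists N, forall n, (N <= n)%N -> B <= g n.

(** Decided classically: the path is only claimed to exist, not to be computable. *)
Let ready l n := `[< forall m, (n <= m)%N -> 2 ^+ l <= g m >].

(* At level [l] the path keeps [M] at most [2 ^ l]. Once [g] has become larger
   than [2 ^ l.+1] it appends zeros until [M] exceeds [2 ^ l]; this at most
   doubles [M]. *)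
Let step (x : seq bool * nat) :=
  let: (s, l) := x in
  if ready l.+1 (size s)
  then (rcons s false, (l + (2 ^+ l < M (rcons s false))%R)%N)
  else (rcons s (M (rcons s true) <= M s), l).

Let state n := iter n step ([::], 0%N).

Let slow_path n := last false (state n.+1).1.

Let state_restr n : (state n).1 = bitseq_restr slow_path n.
Proof.
elim: n => // n IH; rewrite /bitseq_restr mkseqS -/(bitseq_restr _ _) -IH.
rewrite /slow_path /state iterS -/(state n); case: (state n) => s l /=.
by case: ifP => _ /=; rewrite last_rcons.
Qed.

Let M_step s : M (rcons s (M (rcons s true) <= M s)) <= M s.
Proof.
by case: (leP (M (rcons s true)) (M s)) => // h; have := M_rcons s; lra.
Qed.

(** Level 0 accounts for the 1 in the final maximum; a positive level is entered only when [g] stays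
    above the new bound from then on. *)
Let state_invariant n : M (state n).1 <= 2 ^+ (state n).2 /\
  ((state n).2 = 0%N \/ forall m, (n <= m)%N -> 2 ^+ (state n).2 <= g m).
Proof.
elim: n => [|n IH]; first by rewrite expr0; split; [exact: M_nil|left].
have sz : size (state n).1 = n by rewrite state_restr size_bitseq_restr.
rewrite /state iterS -/(state n); case: (state n) IH sz => s l /= [Ml lP] sz.
rewrite sz; case: ifPn => [/asboolP gl|_] /=; last first.
  split; first exact: le_trans (M_step s) Ml.
  by case: lP => [->|lP]; [left|right=> m /ltnW; exact: lP].
(* The sibling has a nonnegative value, so one step at most doubles [M]. *)
have M2 : M (rcons s false) <= 2 ^+ l.+1.
  by rewrite exprS; have := M_rcons s; have := M_ge0 (rcons s true); lra.
case: ltP => [_|le_l]; rewrite ?addn1 ?addn0.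
  by split=> //; right=> m /ltnW; exact: gl.
by split=> //; case: lP => [->|lP]; [left|right=> m /ltnW; exact: lP].
Qed.

(** If the level stayed at [l] forever, only zeros would be appended once [g] is large; [M] would
    then exceed 2^l, against the invariant. *)
Let state_progress n : exists m,
  (state m).2 = (state n).2.+1 /\ 2 ^+ (state n).2 < M (state m).1.
Proof.
apply: contrapT => /forallNP nP; set l := (state n).2 in nP *.
(* The first change of level would be a witness, since the level rises only when [M] exceeds 2^l. *)
have lE k : (state (n + k)).2 = l.
  elim: k => [|k IH]; first by rewrite addn0.
  have := nP (n + k.+1)%N; rewrite addnS /state iterS -/(state _).
  case: (state (n + k)) IH => s l' /= ->; case: ifP => //= _.
  by case: ltP => /= [lt_l|]; rewrite ?addn0// addn1 => -[].
have [N gN] := g_unbounded (2 ^+ l.+1).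
pose n1 := (n + N)%N.
have zerosE k : (state (n1 + k)).1 = (state n1).1 ++ nseq k false.
  elim: k => [|k IH]; first by rewrite addn0 cats0.
  have := lE (N + k)%N; rewrite addnA -/n1 addnS /state iterS -/(state _).
  have sz : size (state (n1 + k)).1 = (n1 + k)%N.
    by rewrite state_restr size_bitseq_restr.
  case: (state (n1 + k)) IH sz => s l' /= -> sz ->; rewrite sz.
  have -> : ready l.+1 (n1 + k).
    apply/asboolP => m km; apply: gN; apply: leq_trans km.
    by rewrite -addnA addnCA leq_addr.
  by rewrite /= -cats1 -catA -[[:: false]]/(nseq 1 false) -nseqD addn1.
have [k] := M_zeros (state n1).1 (2 ^+ l); apply/negP; rewrite -leNgt -zerosE.
by have [] := state_invariant (n1 + k); rewrite -addnA lE.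
Qed.

Lemma exists_slow_path : exists Y : nat -> bool,
  (forall n, M (bitseq_restr Y n) <= Num.max 1 (g n)) /\
  (forall l, exists n, 2 ^+ l < M (bitseq_restr Y n)).
Proof.
exists slow_path; split=> [n|l].
  rewrite le_max -state_restr; have [Ml [l0|lg]] := state_invariant n.
    by rewrite l0 expr0 in Ml; rewrite Ml.
  by rewrite (le_trans Ml (lg _ (leqnn n))) orbT.
have [n <-] : exists n, (state n).2 = l.
  elim: l => [|l [n <-]]; first by exists 0%N.
  by have [m [mE _]] := state_progress n; exists m.
by have [m [_]] := state_progress n; rewrite state_restr; exists m.
Qed.

End slow_path.

(** * The martingale defines a Martin-Loef test *)

Section martingale_test.
Variables (R : realType) (U : seq bool -> option (seq bool)) (cU : code).
Local Open Scope nat_scope.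

Hypothesis cUE : forall p, eval cU (string_code p) = omap string_code (U p).

Variable p0 : nat.
Hypothesis p0_halts : U (string_decode p0) != None.

Let halts i := U (string_decode i) != None.

Let evalE i : eval cU i = omap string_code (U (string_decode i)).
Proof. by rewrite -cUE string_decodeK. Qed.

(* The numerator of [program_gain] over [2 ^ k], from the codes [s] of the
   string, cut at length [n], and [t] of the output of [i]. *)
Definition scaled_gain (s n k i t : nat) : nat :=
  let j := minn (decoded_size t) n in
  (t.+1 %% 2 ^ j == s.+1 %% 2 ^ j) * 2 ^ (j + k - decoded_size i).

Let bit m i := odd (m %/ 2 ^ i).

(* Only the programs selected by the bits of [m] have to halt. *)
Definition gain_step (s n m k i r : nat) : option nat :=
  obind (fun t => Some (r + bit m i * scaled_gain s n k i t))
    (eval cU (bit m i * i + (1 - bit m i) * p0)).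

Definition gain_sum (s n m k : nat) : option nat :=
  nat_rect (fun=> option nat) (Some 0) (fun i => obind (gain_step s n m k i)) k.

(* The length of the string serves as the advice [<n, <m, k>>]: every extension
   of a string in the test belongs to the same open set, so that one of the
   extensions has the length required. *)
Definition test_function (e : nat) : option nat :=
  let l := decoded_size (rgt e) in
  obind (fun a => if 2 ^ (lft e + rgt (rgt l)) < a then Some 0 else None)
    (gain_sum (rgt e) (lft l) (lft (rgt l)) (rgt (rgt l))).

Let clft f : computable f -> computable (fun n => lft (f n)).
Proof. exact: computable_comp computable_lft. Qed.

Let crgt f : computable f -> computable (fun n => rgt (f n)).
Proof. exact: computable_comp computable_rgt. Qed.

Let cminn f g :
  computable f -> computable g -> computable (fun n => minn (f n) (g n)).
Proof.
move=> cf cg; apply: (@computable_ext (fun n => f n - (f n - g n))).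
  by move=> n; rewrite minnE.
by do 2!apply: computable_sub => //.
Qed.

Ltac prove_computable := repeat first
  [ exact: computable_id | exact: computable_cst | apply: clft | apply: crgt
  | apply: computable_eq | apply: computable_leq | apply: computable_odd
  | apply: computable_add | apply: computable_sub | apply: computable_mul
  | apply: cminn | apply: computable_mod_pow2 | apply: computable_div_pow2
  | apply: computable_pow2 | apply: computable_decoded_size
  | apply: computable_succ ].

Let computable_gain_sum : computable_partial (fun e =>
  let l := decoded_size (rgt e) in
  gain_sum (rgt e) (lft l) (lft (rgt l)) (rgt (rgt l))).
Proof.
apply: (@computable_partial_rec (fun=> 0) (fun e =>
    let l := decoded_size (rgt e) in
    gain_step (rgt e) (lft l) (lft (rgt l)) (rgt (rgt l)))
    (fun e => rgt (rgt (decoded_size (rgt e))))).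
- exact: computable_cst.
- by prove_computable.
rewrite /gain_step; apply: (@computable_partial_bind (fun e t =>
  let l := decoded_size (rgt (lft e)) in let i := lft (rgt e) in
  Some (rgt (rgt e) + bit (lft (rgt l)) i *
    scaled_gain (rgt (lft e)) (lft l) (rgt (rgt l)) i t))).
  rewrite /bit /scaled_gain.
  by suff : computable (fun e =>
    let l := decoded_size (rgt (lft (lft e))) in let i := lft (rgt (lft e)) in
    rgt (rgt (lft e)) + odd (lft (rgt l) %/ 2 ^ i) *
    (((rgt e).+1 %% 2 ^ minn (decoded_size (rgt e)) (lft l) ==
      (rgt (lft (lft e))).+1 %% 2 ^ minn (decoded_size (rgt e)) (lft l)) *
     2 ^ (minn (decoded_size (rgt e)) (lft l) + rgt (rgt l) - decoded_size i)))
    by []; rewrite /=; prove_computable.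
apply: computable_partial_comp; first by exists cU.
by rewrite /bit; prove_computable.
Qed.

Lemma computable_test_function : computable_partial test_function.
Proof.
apply: (@computable_partial_bind (fun e a =>
  if 2 ^ (lft e + rgt (rgt (decoded_size (rgt e)))) < a then Some 0 else None)).
  by apply: computable_partial_guard; prove_computable.
exact: computable_gain_sum.
Qed.

Let string_scaled_gain s n k i :=
  oapp (fun t => scaled_gain (string_code s) n k i (string_code t)) 0
    (U (string_decode i)).

(** An unselected index runs the halting program [p0] instead, and the result is multiplied by 0; so
    the sum diverges only if a selected program does. *)
Let gain_sumE (s : seq bool) n m k : gain_sum (string_code s) n m k =
  if all (fun i => bit m i ==> halts i) (iota 0 k)
  then Some (\sum_(i < k) bit m i * string_scaled_gain s n k i) else None.
Proof.
suff gen j : nat_rect (fun=> option nat) (Some 0)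
    (fun i => obind (gain_step (string_code s) n m k i)) j =
    if all (fun i => bit m i ==> halts i) (iota 0 j)
    then Some (\sum_(i < j) bit m i * string_scaled_gain s n k i) else None.
  exact: gen.
elim: j => [|j IH]; first by rewrite big_ord0.
rewrite -[in iota _ _]addn1 iotaD cats1 all_rcons add0n big_ord_recr /= {}IH andbC.
case: ifP => //= _; rewrite /gain_step evalE /string_scaled_gain /halts.
case: (bit m j) => /=; rewrite ?mul1n ?subnn ?mul0n ?addn0 ?add0n.
  by case: (U _) => //= t; rewrite mul1n.
by move: p0_halts; case: (U (string_decode p0)).
Qed.

Local Open Scope ring_scope.

Let string_scaled_gainE (s : seq bool) n k i : (n <= size s)%N -> (i <= k)%N ->
  (string_scaled_gain s n k i)%:R = 2 ^+ k * program_gain R U (take n s) i.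
Proof.
move=> ns ik; rewrite /string_scaled_gain /program_gain.
case: (U _) => [t|]; last by rewrite mulr0.
rewrite /scaled_gain /= decoded_size_string_code size_takel//.
rewrite -take_eq_string_code ?geq_minl//; last exact: leq_trans (geq_minr _ _) ns.
rewrite take_takel ?geq_minr//; case: eqP => _; last by rewrite mul0n mulr0.
rewrite mul1n size_string_decode natrX; set j := minn _ _; set l := decoded_size i.
(* The length of the program [i] is at most [i], hence at most [k]: the truncated subtraction in the
   exponent is exact. *)
have lk : (l <= k)%N.
  apply: leq_trans ik; rewrite -ltnS -(ltn_exp2l _ _ (ltnSn 1)).
  have /andP[il _] := @trunc_log_bounds 2 i.+1 isT isT.
  by apply: leq_ltn_trans il _; apply: ltn_expl.
rewrite mulrA -exprD addnC -{2}(subnK (leq_trans lk (leq_addr j k))) exprD mulfK//.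
Qed.

Hypothesis prefix_free_dom : prefix_free [set p | U p != None]%classic.

Let natr_gain_sum (s : seq bool) n m k : (n <= size s)%N ->
  (\sum_(i < k) bit m i * string_scaled_gain s n k i)%:R =
  2 ^+ k * \sum_(i < k) (bit m i)%:R * program_gain R U (take n s) i.
Proof.
move=> ns; rewrite natr_sum mulr_sumr; apply: eq_bigr => i _.
by rewrite natrM string_scaled_gainE ?(ltnW (ltn_ord i))// mulrCA.
Qed.

(** A string whose length codes the advice has at least the [n] bits that the advice refers to. *)
Let lft_le l : (lft l <= l)%N.
Proof.
rewrite -{2}(npair_lft_rgt l) /npair.
by have := Cantor.to_nat_non_decreasing (lft l) (rgt l); lia.
Qed.

(** Whatever the advice selects is a part of a series with nonnegative terms, so wrong advice can
    only underestimate the martingale. *)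
Lemma test_function_sound d s : test_function (npair d (string_code s)) != None ->
  exists n, 2 ^+ d < program_martingale R U (take n s).
Proof.
rewrite /test_function npairK decoded_size_string_code /=.
set n := lft _; set m := lft _; set k := rgt _; rewrite gain_sumE.
have ns : (n <= size s)%N by exact: lft_le.
case: ifP => //= _; case: ifP => // lt_sum _; exists n.
move: lt_sum; rewrite -(ltr_nat R) natrX natr_gain_sum// exprD mulrC.
rewrite ltr_pM2l ?exprn_gt0// => /lt_le_trans; apply.
apply: le_trans (program_martingale_partial R prefix_free_dom _ k).
apply: ler_sum => i _; have := program_gain_ge0 R U (take n s) i.
by case: (bit m i); rewrite ?mul1r ?mul0r.
Qed.

Lemma test_function_complete d n Z :
  2 ^+ d < program_martingale R U (bitseq_restr Z n) ->
  exists l, test_function (npair d (string_code (bitseq_restr Z l))) != None.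
Proof.
move=> /program_martingale_approx -/(_ prefix_free_dom)[k lt_sum].
(* The right advice selects exactly the halting programs below [k]. It need not be computed: it is
   supplied by the length of a prefix of [Z]. *)
have [m mE] := exists_bits halts k.
pose l := npair n (npair m k); exists l.
have nl : (n <= l)%N by have := lft_le l; rewrite npairK.
rewrite /test_function npairK decoded_size_string_code /= size_bitseq_restr.
rewrite /l !npairK /= gain_sumE ifT; last first.
  by apply/allP => i; rewrite mem_iota /= => ik; rewrite /bit mE ?implybb.
rewrite /= ifT// -(ltr_nat R) natrX natr_gain_sum ?size_bitseq_restr// exprD mulrC.
rewrite ltr_pM2l ?exprn_gt0// take_bitseq_restr//; apply: lt_le_trans lt_sum _.
apply: ler_sum => i _; rewrite /bit mE// /halts /program_gain.
by case: (U _) => [t|]; rewrite ?mul1r ?mulr0.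
Qed.

End martingale_test.

(** * Boundedness of the martingale along random sequences *)

Section random_martingale.
Variables (R : realType) (U : seq bool -> option (seq bool)).
Hypothesis hU : prefix_free_machine U.
Local Open Scope classical_set_scope.
Local Open Scope ring_scope.

Lemma martin_lof_random_program_martingale p0 Z : U p0 != None ->
  martin_lof_random R Z ->
  exists d, forall n, program_martingale R U (bitseq_restr Z n) <= 2 ^+ d.
Proof.
move=> Up0 rZ; have [[cU cUE] pf] := hU.
have {}pf : prefix_free [set p | U p != None] by move=> p q; exact: pf.
have p0_halts : U (string_decode (string_code p0)) != None by rewrite string_codeK.
apply: contrapT => /forallNP unbdd.
have [c cE] := computable_test_function cU (string_code p0).
pose A d := [set s | eval c (npair d (string_code s)) != None].
apply: (rZ (fun d => \bigcup_(s in A d) cylinder s)); first by exists c.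
  move=> d; apply: le_trans (measure_bigcup_cylinder_le d (program_measure_le1 R pf)).
  apply: le_measure; rewrite ?inE; try exact: measurable_bigcup_cylinder.
  move=> X [s]; rewrite /A /= cE => /(test_function_sound R cUE p0_halts pf) [n ltM] sX.
  exists (take n s); last by apply: sub_cylinder sX; rewrite prefix_take.
  (* Membership in the set of Ville's inequality, with M > 2^d rewritten as a comparison of the two
     measures. *)
  suff : ((2 ^+ d)%:E * cantor_measure R (cylinder (take n s)) <
    program_measure R U (cylinder (take n s)))%E by [].
  rewrite cantor_measure_cylinder program_martingaleE// -EFinM lte_fin.
  by rewrite ltr_pM2r// invr_gt0 exprn_gt0.
move=> d _; have /existsNP[n /negP] := unbdd d; rewrite -ltNge.
move=> /(test_function_complete cUE p0_halts pf)[l lP].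
by exists (bitseq_restr Z l); [rewrite /A /= cE|exact: mem_cylinder_restr].
Qed.

End random_martingale.

(** * Existence of a random sequence *)

Section codes_countable.
Local Open Scope nat_scope.

(** An injective numbering shows that there are only countably many tests. *)
Fixpoint code_number (c : code) : nat :=
  match c with
  | Zero => npair 0 0
  | Succ => npair 1 0
  | Left => npair 2 0
  | Right => npair 3 0
  | Pair f g => npair 4 (npair (code_number f) (code_number g))
  | Comp f g => npair 5 (npair (code_number f) (code_number g))
  | Prec f g => npair 6 (npair (code_number f) (code_number g))
  | Mu f => npair 7 (code_number f)
  end.

Lemma npair_inj x y x' y' : npair x y = npair x' y' -> x = x' /\ y = y'.
Proof. by move=> /(congr1 Cantor.of_nat); rewrite !npairK => -[]. Qed.

Lemma code_number_inj : injective code_number.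
Proof.
elim=> [| | | |f IHf g IHg|f IHf g IHg|f IHf g IHg|f IHf] [| | | |f' g'|f' g'|f' g'|f']
  //= /npair_inj[] // _.
- by move/npair_inj => [/IHf -> /IHg ->].
- by move/npair_inj => [/IHf -> /IHg ->].
- by move/npair_inj => [/IHf -> /IHg ->].
- by move/IHf ->.
Qed.

End codes_countable.

Section random_exists.
Variable R : realType.
Local Open Scope classical_set_scope.
Local Open Scope ring_scope.
Local Notation lam := (cantor_measure R).

Lemma negligible_bigcap_le (G : nat -> set cantor_measurableType) :
  (forall m, measurable (G m)) -> (forall m, (lam (G m) <= (2 ^- m)%:E)%E) ->
  lam.-negligible (\bigcap_m G m).
Proof.
move=> mG leG; have mI : measurable (\bigcap_m G m) by exact: bigcap_measurableType.
apply/negligibleP => //; apply/eqP; rewrite eq_le measure_ge0 andbT.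
apply/lee_addgt0Pr => e e0; rewrite add0e.
have [m me] : exists m, 2 ^- m < e :> R.
  have /cvgrPdist_lt /(_ _ e0) [m _ /(_ m (leqnn m))] :
      (2^-1 : R) ^+ n @[n --> \oo] --> (0 : R).
    by apply: cvg_expr; rewrite ger0_norm// invf_lt1// ltr1n.
  rewrite /= sub0r normrN exprVn ger0_norm ?invr_ge0 ?exprn_ge0// => me.
  by exists m.
apply: (@le_trans _ _ (2 ^- m)%:E); last by rewrite lee_fin ltW.
by apply: le_trans (leG m); apply: le_measure; rewrite ?inE//; exact: bigcap_inf.
Qed.

(** Each code yields at most one test, whose intersection is null; a countable union of null sets
    cannot exhaust a space of measure 1. *)
Lemma exists_martin_lof_random : exists X, martin_lof_random R X.
Proof.
pose G (c : code) m : set cantor_measurableType :=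
  \bigcup_(s in [set s | eval c (npair m (string_code s)) != None]) cylinder s.
pose N n : set cantor_measurableType := [set Z | exists c, [/\ code_number c = n,
  forall m, (lam (G c m) <= (2 ^- m)%:E)%E & (\bigcap_m G c m) Z]].
have negN : lam.-negligible (\bigcup_n N n).
  apply: negligible_bigcup => n.
  have [[c [cn cG]]|nc] := pselect (exists c, code_number c = n /\
      forall m, (lam (G c m) <= (2 ^- m)%:E)%E).
    apply: negligibleS (negligible_bigcap_le _ cG).
      by move=> Z [c' [+ _]]; rewrite -cn => /code_number_inj ->.
    by move=> m; exact: measurable_bigcup_cylinder.
  apply: negligibleS (negligible_set0 _) => Z [c [cn cG _]].
  by apply: nc; exists c.
apply: contrapT => /forallNP nR.
have TN : setT `<=` \bigcup_n N n.
  move=> Z _; apply: contrapT => nNZ; apply: (nR Z) => F [c cF] leF FZ.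
  have FG : F = G c by apply/funext => m; exact: cF.
  by apply: nNZ; exists (code_number c) => //; exists c; rewrite FG in leF FZ.
have /negligibleP := negligibleS TN negN.
move=> /(_ measurableT) l0.
have l1 : lam setT = 1%E := probability_setT lam.
by have := oner_neq0 R; apply/negP/negPn; rewrite -eqe -l1 l0.
Qed.

End random_exists.

(** * Prefix complexity and the martingale *)

Section zeros_machine.
Local Open Scope nat_scope.

(* Programs of length [j + 1] for outputs of length [size s + 2 * j], so that [s]
   has arbitrarily compressible extensions. *)
Definition zeros_machine (s p : seq bool) : option (seq bool) :=
  let j := (size p).-1 in
  if p == rcons (nseq j false) true then Some (s ++ nseq (2 * j) false) else None.

Lemma string_code_zeros n : string_code (nseq n false) = 2 ^ n - 1.
Proof. by elim: n => //= n ->; rewrite expnS; have := expn_gt0 2 n; lia. Qed.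

Lemma zeros_machine_prefix_free s : prefix_free_machine (zeros_machine s).
Proof.
split.
  have clen := computable_decoded_size computable_id.
  have cj : computable (fun n => (decoded_size n).-1) by exact: computable_pred.
  have c1 := computable_cst 1.
  (* This recognizes the code of [j] zeros followed by a one: the zeros have code 2^j - 1, and the
     single bit [true] has code 2. *)
  pose b n := n == 2 ^ (decoded_size n).-1 - 1 + 2 ^ (decoded_size n).-1 * 2.
  have [c cE] : computable_partial (fun n => obind (fun m : nat => Some
      (string_code s + 2 ^ size s * (2 ^ (2 * (decoded_size n).-1) - 1)))
      (if b n then Some 0 else None)).
    apply: (@computable_partial_bind (fun n _ => Some
      (string_code s + 2 ^ size s * (2 ^ (2 * (decoded_size n).-1) - 1)))).
      apply: computable_add; first exact: computable_cst.
      apply: computable_mul; first exact: computable_cst.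
      apply: computable_sub => //; apply: computable_pow2.
      apply: computable_mul; first exact: computable_cst.
      exact: computable_comp cj computable_lft.
    apply: computable_partial_guard; apply: computable_eq; first exact: computable_id.
    apply: computable_add.
      by apply: computable_sub => //; exact: computable_pow2.
    by apply: computable_mul; [exact: computable_pow2|exact: computable_cst].
  exists c => p; rewrite cE /b decoded_size_string_code /zeros_machine.
  set j := (size p).-1.
  have -> : 2 ^ j - 1 + 2 ^ j * 2 = string_code (rcons (nseq j false) true).
    by rewrite -cats1 string_code_cat string_code_zeros size_nseq.
  rewrite (inj_eq string_code_inj); case: ifP => //= _.
  by rewrite string_code_cat string_code_zeros.
move=> p q; rewrite /zeros_machine.
case: (p =P _) => [-> _|_]; last by rewrite eqxx.
case: (q =P _) => [-> _|_]; last by rewrite eqxx.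
set i := (size p).-1; set j := (size q).-1; rewrite prefixE size_rcons size_nseq.
(* The first one marks the end of a program: if [i < j], position [i] holds a one in [p] and a zero
   in [q]; if [j < i], [p] is too long to be a prefix. *)
case: (ltngtP i j) => [ij|ji|-> //].
  move=> /eqP /(congr1 (nth false ^~ i)).
  by rewrite nth_take// !nth_rcons !size_nseq ij ltnn eqxx nth_nseq ij.
rewrite take_oversize; last by rewrite size_rcons size_nseq ltnW.
by move=> /eqP /(congr1 size); rewrite !size_rcons !size_nseq => -[->].
Qed.

Lemma optimal_program_zeros U s : optimal_prefix_free_machine U ->
  exists d, forall j, exists2 q,
    U q = Some (s ++ nseq (2 * j) false) & size q <= j + d.
Proof.
(* The extra 1 pays for the final one of the program, which has length [j + 1]. *)
move=> [_ /(_ _ (zeros_machine_prefix_free s))[d dP]]; exists d.+1 => j.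
have := dP (rcons (nseq j false) true).
rewrite /zeros_machine size_rcons size_nseq eqxx => /(_ _ erefl)[q Uq qs].
by exists q => //; rewrite addnS -addSn.
Qed.

(** With no zeros appended, the machine above prints [x], so [x] has a program for [U] and the
    default value in the complexity is not reached. *)
Lemma prefix_complexity_program U x : optimal_prefix_free_machine U ->
  exists2 p, U p = Some x & size p = prefix_complexity U x.
Proof.
move=> /(@optimal_program_zeros U x)[d /(_ 0)[q]]; rewrite cats0 => Uq _.
rewrite /prefix_complexity; case: pselect => [ex|[]].
  by case: ex_minnP => n /asboolP.
by exists (size q); apply/asboolP; exists q.
Qed.

End zeros_machine.

(** * Lower bounds for the martingale from short programs *)

Section complexity_martingale.
Variables (R : realType) (U : seq bool -> option (seq bool)).
Hypothesis hU : optimal_prefix_free_machine U.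
Local Open Scope ring_scope.
Local Notation K := (prefix_complexity U).
Local Notation M := (program_martingale R U).

Let pf : prefix_free [set p | U p != None]%classic.
Proof. by have [[_ pf] _] := hU => p q; exact: pf. Qed.

Let program_gain_prefix s p t : U p = Some t -> prefix t s ->
  program_gain R U s (string_code p) = 2 ^+ size t / 2 ^+ size p.
Proof.
move=> Up /[dup]/size_prefix ts; rewrite prefixE => /eqP tE.
by rewrite /program_gain string_codeK Up (minn_idPl ts) take_size tE eqxx.
Qed.

Lemma program_martingale_ge_program p x :
  U p = Some x -> 2 ^+ size x / 2 ^+ size p <= M x.
Proof.
move=> Up; rewrite -(program_gain_prefix Up (prefix_refl x)).
apply: le_trans (program_martingale_partial R pf x (string_code p).+1).
rewrite big_ord_recr /= lerDr; apply: sumr_ge0 => i _; exact: program_gain_ge0.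
Qed.

Lemma program_martingale_ge x : 2 ^+ size x / 2 ^+ K x <= M x.
Proof.
have [p Up <-] := prefix_complexity_program x hU.
exact: program_martingale_ge_program.
Qed.

Lemma program_martingale_zeros s B : exists k, B < M (s ++ nseq k false).
Proof.
have [d dP] := optimal_program_zeros s hU.
have [j Bj] : exists j, B < 2 ^+ j / 2 ^+ d.
  pose j := Num.trunc (`|B| * 2 ^+ d).
  exists j.+1; rewrite ltr_pdivlMr ?exprn_gt0//.
  apply: (@le_lt_trans _ _ (`|B| * 2 ^+ d)).
    by rewrite ler_pM2r ?exprn_gt0// ler_norm.
  apply: (@lt_trans _ _ j.+1%:R); first exact: truncnS_gt.
  by rewrite -natrX ltr_nat ltn_expl.
(* An output of length |s| + 2j with a program of length at most j + d makes [M] at least 2^(j -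
   d). *)
exists (2 * j)%N; have [q Uq qd] := dP j.
apply: lt_le_trans (program_martingale_ge_program Uq); apply: lt_le_trans Bj _.
rewrite ler_pdivlMr ?exprn_gt0// mulrAC ler_pdivrMr ?exprn_gt0// -!exprD.
by rewrite ler_eXn2l ?ltr1n// size_cat size_nseq; lia.
Qed.

(** Shortest programs of different prefixes of [Z] are different, so each summand is a separate term
    of the series for [M] at the longest prefix. *)
Lemma sum_deficiency_le Z n :
  \sum_(j < n) 2 ^+ j / 2 ^+ K (bitseq_restr Z j) <= M (bitseq_restr Z n).
Proof.
have /choice[p pP] : forall j, exists p, U p = Some (bitseq_restr Z j) /\
    size p = K (bitseq_restr Z j).
  by move=> j; have [p] := prefix_complexity_program (bitseq_restr Z j) hU; exists p.
pose k := (\max_(j < n) (string_code (p j)).+1)%N.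
have pk (j : 'I_n) : (string_code (p j) < k)%N.
  exact: (leq_bigmax_cond (F := fun j : 'I_n => (string_code (p j)).+1)).
apply: le_trans (program_martingale_partial R pf _ k).
pose F i := program_gain R U (bitseq_restr Z n) i.
have F0 i : 0 <= F i by exact: program_gain_ge0.
have -> : \sum_(j < n) 2 ^+ j / 2 ^+ K (bitseq_restr Z j) =
    \sum_(j in 'I_n) F (Ordinal (pk j)).
  apply: eq_big => [//|j _]; have [Up ps] := pP j.
  rewrite /F (program_gain_prefix Up) ?size_bitseq_restr ?ps//.
  by rewrite prefixE size_bitseq_restr take_bitseq_restr// ltnW.
have pinj : injective (fun j : 'I_n => Ordinal (pk j)).
  move=> i j [] /string_code_inj ij; apply: val_inj => /=.
  have [Ui _] := pP i; have [Uj _] := pP j; move: Ui; rewrite ij Uj => -[].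
  by move/(congr1 size); rewrite !size_bitseq_restr.
rewrite -(big_imset (fun i : 'I_k => F i) (fun i j _ _ => @pinj i j)) /=.
rewrite [leRHS](bigID (mem [set Ordinal (pk j) | j in 'I_n])) /= lerDl.
exact: sumr_ge0.
Qed.

Lemma deficiency_unbounded Z d : (forall n, M (bitseq_restr Z n) <= 2 ^+ d) ->
  forall B : R, exists N, forall n, (N <= n)%N ->
    B <= 2 ^+ K (bitseq_restr Z n) / 2 ^+ n.
Proof.
move=> Md B; pose u n : R := 2 ^+ n / 2 ^+ K (bitseq_restr Z n).
have u0 n : 0 < u n by rewrite divr_gt0 ?exprn_gt0.
have /cvg_series_cvg_0 /cvgrPdist_lt cu : cvgn (series u).
  apply: nondecreasing_is_cvgn.
    by apply: nondecreasing_series => n _ _; exact: ltW.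
  exists (2 ^+ d) => _ [n _ <-]; rewrite /series /= big_mkord.
  exact: le_trans (sum_deficiency_le Z n) (Md n).
(* The terms of a convergent series tend to 0; the maximum with 1 makes the bound positive, so that
   it can be inverted. *)
have B1 : 0 < Num.max 1 B by rewrite lt_max ltr01.
have [N _ NP] := cu (Num.max 1 B)^-1 ltac:(by rewrite invr_gt0).
exists N => n /NP; rewrite /= sub0r normrN gtr0_norm// => /ltW.
rewrite -[u n]invrK lef_pV2 ?posrE ?invr_gt0// invf_div.
by apply: le_trans; rewrite le_max lexx orbT.
Qed.

End complexity_martingale.

(** * A random and a nonrandom sequence whose complexities compensate *)

Theorem theorem4p2 (R : realType) (U : seq bool -> option (seq bool))
    (hU : optimal_prefix_free_machine U) :
  exists X Y : nat -> bool,
    [/\ martin_lof_random R X,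
        ~ martin_lof_random R Y &
        exists c : nat, forall n : nat,
          (2 * n <= prefix_complexity U (bitseq_restr X n)
                    + prefix_complexity U (bitseq_restr Y n) + c)%N].
Proof.
have [[hU1 pfU] _] := hU.
have pf : prefix_free [set p | U p != None]%classic by move=> p q; exact: pfU.
have [p0 Up0 _] := prefix_complexity_program [::] hU.
have {}Up0 : U p0 != None by rewrite Up0.
have randomM := martin_lof_random_program_martingale (conj hU1 pfU) Up0.
have [X rX] := exists_martin_lof_random R.
have [d dX] := randomM R X rX.
(* The growth bound for [Y] is g n = 2^(K(X|n) - n), which tends to infinity as [X] is random. *)
have [Y [YX Y_unbounded]] := exists_slow_path (program_martingale_nil R pf)
  (program_martingale_ge0 R U) (program_martingale_rcons R pf)
  (program_martingale_zeros hU) (deficiency_unbounded hU dX).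
exists X, Y; split=> //.
  move=> /randomM[l lY]; have [n] := Y_unbounded l.
  by apply/negP; rewrite -leNgt.
exists d => n; have := le_trans (program_martingale_ge R hU _) (YX n).
have := le_trans (program_martingale_ge R hU _) (dX n).
rewrite !size_bitseq_restr; set KX := prefix_complexity U _.
set KY := prefix_complexity U _.
rewrite ler_pdivrMr ?exprn_gt0// -exprD ler_eXn2l ?ltr1n// => nX.
(* Either n <= K(Y|n), to which n <= K(X|n) + d is added, or n - K(Y|n) <= K(X|n) - n, which gives
   2n <= K(X|n) + K(Y|n) directly. *)
rewrite le_max !ler_pdivrMr ?exprn_gt0// mul1r mulrAC ler_pdivlMr ?exprn_gt0//.
by rewrite -!exprD !ler_eXn2l ?ltr1n//; lia.
Qed.
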